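(* Let $G=(V,E)$ be a finite simple undirected loopless graph whose adjacency matrix $A$ either belongs to or splits in a coherent configuration $\mathcal{C}$ (of matrices indexed by $V$). Then $$\eta(G)\,\eta^\circ(G) = |E|.$$
   Context: Let $G=(V,E)$ be a finite simple undirected loopless graph with adjacency matrix $A$ and Laplacian $L=\sum_{ij\in E}(e_i-e_j)(e_i-e_j)^T$. For real matrices, $\langle X,Y\rangle=\operatorname{tr}(XY^T)$ is the trace inner product; $M\succcurlyeq 0$ means that the real symmetric matrix $M$ is positive semidefinite; $\mathrm{diag}(M)$ is the vector of diagonal entries; $\mathbb{1}$ is the all-ones vector. For a symmetric matrix $N$ indexed by $V$, $\mathcal{L}^*(N)\in\mathbb{R}^E$ is defined by $\mathcal{L}^*(N)_{ij}=N_{ii}+N_{jj}-2N_{ij}$ for $ij\in E$. Define $$\eta(G)=\max\{\tfrac14\langle L,M\rangle : M\succcurlyeq 0,\ \mathrm{diag}(M)=\mathbb{1}\},$$ $$\eta^\circ(G)=\min\{\mu : \mu\ge 0,\ N\succcurlyeq 0,\ \mathrm{diag}(N)=\mu\cdot\mathbb{1},\ \tfrac14\mathcal{L}^*(N)\ge\mathbb{1}\}.$$ A set $\mathcal{C}=\{A_0,\dots,A_d\}$ of square matrices with entries in $\{0,1\}$ is a coherent configuration if: (1) $\sum_i A_i=J$, the all-ones matrix; (2) $A_i\in\mathcal{C}$ implies $A_i^T\in\mathcal{C}$; (3) any $A_i\in\mathcal{C}$ with a nonzero diagonal entry is a diagonal matrix; (4) there are nonnegative integers $p_{ij}^l$ with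 $A_iA_j=\sum_{l=0}^d p_{ij}^l A_l$ for all $0\le i,j\le d$. The matrix $A$ belongs to $\mathcal{C}$ if $A\in\mathcal{C}$; it splits in $\mathcal{C}$ if $A=A_i+A_i^T$ for some $A_i\in\mathcal{C}$. *)

(* Defs.v *)
From HB Require Import structures.
From mathcomp Require Import all_boot all_order all_algebra.
From mathcomp Require Import all_classical all_reals all_analysis.
From mathcomp Require Import ring lra.

Set Implicit Arguments.
Unset Strict Implicit.
Unset Printing Implicit Defensive.

Import Order.TTheory GRing.Theory Num.Theory.
Import numFieldNormedType.Exports.

Local Open Scope classical_set_scope.
Local Open Scope ring_scope.

(* A graph on the vertex set V = {0, ..., n-1} is its adjacency relation
   e : rel 'I_n, assumed symmetric and irreflexive; matrices indexed by V are
   'M[R]_n. The case n = 0 is allowed. *)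
Record simple_graph (n : nat) (e : rel 'I_n) : Prop := SimpleGraph {
  graph_sym : symmetric e;
  graph_irr : irreflexive e }.

(* Each edge {i, j} is represented once, by the pair (i, j) with i < j. *)
Definition edges (n : nat) (e : rel 'I_n) : {set 'I_n * 'I_n} :=
  [set p : 'I_n * 'I_n | (p.1 < p.2)%N && e p.1 p.2].

Definition adjacency (R : realType) (n : nat) (e : rel 'I_n) : 'M[R]_n :=
  \matrix_(i, j) (e i j)%:R.

Definition basis_vec (R : realType) (n : nat) (i : 'I_n) : 'cV[R]_n :=
  delta_mx i 0.

Definition laplacian (R : realType) (n : nat) (e : rel 'I_n) : 'M[R]_n :=
  \sum_(p in edges e) (basis_vec R p.1 - basis_vec R p.2)
                   *m (basis_vec R p.1 - basis_vec R p.2)^T.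

Definition trace_ip (R : realType) (n : nat) (X Y : 'M[R]_n) : R :=
  \tr (X *m Y^T).

Definition psd (R : realType) (n : nat) (M : 'M[R]_n) : Prop :=
  M^T = M /\ forall x : 'cV[R]_n, 0 <= (x^T *m M *m x) 0 0.

(* The ij-entry of the vector L^*(N), meaningful when ij is an edge. *)
Definition laplacian_adj (R : realType) (n : nat) (N : 'M[R]_n)
    (i j : 'I_n) : R :=
  N i i + N j j - 2 * N i j.

Definition eta_values (R : realType) (n : nat) (e : rel 'I_n) : set R :=
  [set v | exists M : 'M[R]_n,
     [/\ psd M, forall i, M i i = 1 & v = 4^-1 * trace_ip (laplacian R e) M]].

Definition eta_polar_values (R : realType) (n : nat) (e : rel 'I_n) : set R :=
  [set mu | 0 <= mu /\ exists N : 'M[R]_n,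
     [/\ psd N, forall i, N i i = mu
       & forall i j, e i j -> 1 <= 4^-1 * laplacian_adj N i j]].

Arguments eta_values R {n} e.
Arguments eta_polar_values R {n} e.

(* The supremum and the infimum are attained, see eta_is_max and
   eta_polar_is_min below. *)
Definition etaG (R : realType) (n : nat) (e : rel 'I_n) : R :=
  sup (eta_values R e).

Definition etaG_polar (R : realType) (n : nat) (e : rel 'I_n) : R :=
  inf (eta_polar_values R e).

(* The set {A_0, ..., A_d} is enumerated without repetition by C. *)
Record coherent_configuration (R : realType) (n d : nat)
    (C : 'I_d.+1 -> 'M[R]_n) : Prop := CoherentConfiguration {
  cc_inj : injective C;
  cc_01 : forall i a b, C i a b = 0 \/ C i a b = 1;
  cc_sum : \sum_i C i = const_mx 1;
  cc_tr : forall i, exists j, (C i)^T = C j;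
  cc_diag : forall i, (exists a, C i a a != 0) -> is_diag_mx (C i);
  cc_mul : exists p : 'I_d.+1 -> 'I_d.+1 -> 'I_d.+1 -> nat,
    forall i j, C i *m C j = \sum_l (p i j l)%:R *: C l }.

Definition belongs_to (R : realType) (n d : nat) (A : 'M[R]_n)
    (C : 'I_d.+1 -> 'M[R]_n) : Prop :=
  exists i, A = C i.

Definition splits_in (R : realType) (n d : nat) (A : 'M[R]_n)
    (C : 'I_d.+1 -> 'M[R]_n) : Prop :=
  exists i, A = C i + (C i)^T.

Lemma linear_form_continuous (R : realType) (k : nat) (f : 'rV[R]_k -> R) :
  (forall a u v, f (a *: u + v) = a * f u + f v) -> continuous f.
Proof.
move=> fl.
have f0 : f 0 = 0 by have := fl 1 0 0; rewrite scaler0 addr0 mul1r; lra.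
have fD u v : f (u + v) = f u + f v.
  by have := fl 1 u v; rewrite scale1r mul1r.
have fZ a u : f (a *: u) = a * f u.
  by have := fl a u 0; rewrite !addr0 f0 addr0.
have -> : f = fun v => \sum_j v 0 j * f (delta_mx 0 j).
  apply/funext => v; rewrite [in LHS](row_sum_delta v).
  elim: (index_enum _) => [|j s IH]; first by rewrite !big_nil.
  by rewrite !big_cons fD fZ IH.
elim: (index_enum _) => [|j s IH].
  have -> : (fun v : 'rV[R]_k => \sum_(i <- [::]) v 0 i * f (delta_mx 0 i))
      = fun=> 0 by apply/funext => v; rewrite big_nil.
  exact: cst_continuous.
have -> : (fun v : 'rV[R]_k => \sum_(i <- j :: s) v 0 i * f (delta_mx 0 i))
    = (fun v : 'rV[R]_k => v 0 j * f (delta_mx 0 j))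
    \+ (fun v => \sum_(i <- s) v 0 i * f (delta_mx 0 i)).
  by apply/funext => v; rewrite big_cons.
move=> v; exact: (cvgD (cvgM (@coord_continuous R 1 k 0 j v) (cvg_cst _)) (IH v)).
Qed.

(* Minimisation of a linear form over a bounded solution set of arbitrarily
   many linear inequalities. *)
Lemma linear_min_attained (R : realType) (k : nat) (I : Type)
    (ell : I -> 'rV[R]_k -> R) (b : I -> R) (f : 'rV[R]_k -> R) (B : R) :
  (forall i a u v, ell i (a *: u + v) = a * ell i u + ell i v) ->
  (forall a u v, f (a *: u + v) = a * f u + f v) ->
  (exists v, forall i, b i <= ell i v) ->
  (forall v, (forall i, b i <= ell i v) -> forall j, `|v 0 j| <= B) ->
  exists2 c, (forall i, b i <= ell i c)
    & forall v, (forall i, b i <= ell i v) -> f c <= f v.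
Proof.
move=> ell_lin f_lin [v0 hv0] bnd.
pose S : set 'rV[R]_k := [set v | forall i, b i <= ell i v].
have clS : closed S.
  have -> : S = \bigcap_(i in setT) (ell i @^-1` [set x | b i <= x]).
    by apply/seteqP; split=> v /= h i; [move=> _; exact: h | exact: (h i)].
  apply: closed_bigI => i _; apply: preimage_closed; last exact: closed_ge.
  by move=> v _; exact: (@linear_form_continuous R k _ (ell_lin i)).
have cS : compact S.
  have cK : compact [set v : 'rV[R]_k | forall j, `[- B, B]%classic (v 0 j)].
    apply: (@rV_compact R k (fun=> `[- B, B]%classic)) => _.
    exact: segment_compact.
  apply: (subclosed_compact clS cK) => v Sv j /=.
  by rewrite in_itv /= -ler_norml; exact: bnd.
have [||c cS' cmin] := @EVT_min_rV R k f S _ cS _.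
- by exists v0.
- exact: (continuous_subspaceT (@linear_form_continuous R k f f_lin)).
by rewrite inE in cS'; exists c => // v Sv; apply: cmin; rewrite inE.
Qed.

Lemma quad_lin (R : realType) (n : nat) (x : 'cV[R]_n) a (M N : 'M[R]_n) :
  (x^T *m (a *: M + N) *m x) 0 0
    = a * (x^T *m M *m x) 0 0 + (x^T *m N *m x) 0 0.
Proof. by rewrite mulmxDr mulmxDl -scalemxAr -scalemxAl !mxE. Qed.

Lemma trace_ip_lin (R : realType) (n : nat) (L : 'M[R]_n) a (M N : 'M[R]_n) :
  trace_ip L (a *: M + N) = a * trace_ip L M + trace_ip L N.
Proof.
by rewrite /trace_ip linearP /= mulmxDr -scalemxAr mxtraceD mxtraceZ.
Qed.

Lemma psd_scalar (R : realType) (n : nat) (a : R) :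
  0 <= a -> psd (a%:M : 'M[R]_n).
Proof.
move=> a0; split=> [|x]; first exact: tr_scalar_mx.
rewrite mul_mx_scalar -scalemxAl !mxE mulr_ge0 // sumr_ge0 // => i _.
by rewrite !mxE -expr2 sqr_ge0.
Qed.

Lemma psd_entry_bound (R : realType) (n : nat) (M : 'M[R]_n) (mu : R) :
  psd M -> (forall i, M i i = mu) -> forall i j, `|M i j| <= mu.
Proof.
move=> [Msym Mpos] Mdiag i j.
have Mji : M j i = M i j by rewrite -[in LHS]Msym mxE.
have bil (u v : 'I_n) : ((basis_vec R u)^T *m M *m basis_vec R v) 0 0 = M u v.
  by rewrite /basis_vec trmx_delta -rowE -colE !mxE.
have H s : s ^+ 2 = 1 -> 0 <= mu + s * M i j.
  move=> s2; have := Mpos (basis_vec R i + s *: basis_vec R j).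
  rewrite [(_ + _)^T]linearD /= [(_ *: _)^T]linearZ /= !mulmxDl !mulmxDr.
  have addE (X Y : 'M[R]_1) : (X + Y) 0 0 = X 0 0 + Y 0 0 by rewrite mxE.
  have scaleE a (X : 'M[R]_1) : (a *: X) 0 0 = a * X 0 0 by rewrite mxE.
  rewrite -!scalemxAl -!scalemxAr -?scalemxAl !(addE, scaleE) !bil Mji !Mdiag.
  have : s * (s * mu) = mu by rewrite mulrA -expr2 s2 mul1r.
  lra.
have := H 1; have := H (-1); rewrite sqrrN expr1n => /(_ erefl) h1 /(_ erefl) h2.
by rewrite ler_norml; apply/andP; split; lra.
Qed.

Lemma eta_is_max (R : realType) (n : nat) (e : rel 'I_n) :
  eta_values R e (etaG R e) /\ ubound (eta_values R e) (etaG R e).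
Proof.
pose ell (t : 'cV[R]_n + ('I_n * 'I_n) + ('I_n * bool)) (v : 'rV[R]_(n * n)) :=
  let M := vec_mx v in
  match t with
  | inl (inl x) => (x^T *m M *m x) 0 0
  | inl (inr p) => M p.1 p.2 - M p.2 p.1
  | inr p => (-1) ^+ p.2 * M p.1 p.1
  end.
pose b (t : 'cV[R]_n + ('I_n * 'I_n) + ('I_n * bool)) : R :=
  match t with inl _ => 0 | inr p => (-1) ^+ p.2 end.
pose f (v : 'rV[R]_(n * n)) : R := - (4^-1 * trace_ip (laplacian R e) (vec_mx v)).
have feasP v : (forall t, b t <= ell t v) <->
    psd (vec_mx v) /\ forall i, vec_mx v i i = 1.
  split=> [h|[[hs hp] hd] [[x|[i j]]|[i s]]] /=.
  - split; first split.
    + apply/matrixP => i j; rewrite mxE.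
      have := h (inl (inr (i, j))); have := h (inl (inr (j, i))) => /=.
      by rewrite !subr_ge0 => h1 h2; apply/eqP; rewrite eq_le h1 h2.
    + by move=> x; exact: (h (inl (inl x))).
    + move=> i; have := h (inr (i, true)); have := h (inr (i, false)) => /=.
      by rewrite expr0 expr1; lra.
  - exact: hp.
  - suff -> : vec_mx v i j = vec_mx v j i by rewrite subrr.
    by rewrite -[in LHS]hs [LHS]mxE.
  - by rewrite hd mulr1.
have [||||c /feasP[cp cd] cmin] := @linear_min_attained R _ _ ell b f 1.
- move=> [[x|[i j]]|[i s]] a u v; rewrite /ell /= linearP /=.
  + exact: quad_lin.
  + by rewrite !mxE; ring.
  + by rewrite !mxE; ring.
- by move=> a u v; rewrite /f linearP /= trace_ip_lin; ring.
- exists (mxvec 1%:M); apply/feasP; rewrite mxvecK.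
  by split=> [|i]; [exact: psd_scalar | rewrite mxE eqxx].
- move=> v /feasP[vp vd] j; rewrite -[v]vec_mxK.
  by case/mxvec_indexP: j => i j; rewrite mxvecE; exact: psd_entry_bound.
have cv : eta_values R e (- f c) by exists (vec_mx c); split=> //; rewrite opprK.
have cu : ubound (eta_values R e) (- f c).
  move=> _ [M [Mp Md ->]]; rewrite lerNr.
  have := cmin (mxvec M); rewrite /f mxvecK; apply.
  by apply/feasP; rewrite mxvecK.
suff -> : etaG R e = - f c by [].
apply/eqP; rewrite eq_le; apply/andP; split.
  by apply: ge_sup => //; exists (- f c).
by apply: ub_le_sup => //; exists (- f c).
Qed.

Lemma eta_polar_is_min (R : realType) (n : nat) (e : rel 'I_n) :
  irreflexive e ->
  eta_polar_values R e (etaG_polar R e) /\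
  lbound (eta_polar_values R e) (etaG_polar R e).
Proof.
move=> eirr.
pose T : Type :=
  ('cV[R]_n + ('I_n * 'I_n) + ('I_n * bool) + ('I_n * 'I_n) + bool)%type.
pose ell (t : T) (v : 'rV[R]_(1 + n * n)) : R :=
  let mu := lsubmx v 0 0 in let N := vec_mx (rsubmx v) in
  match t with
  | inl (inl (inl (inl x))) => (x^T *m N *m x) 0 0
  | inl (inl (inl (inr p))) => N p.1 p.2 - N p.2 p.1
  | inl (inl (inr p)) => (-1) ^+ p.2 * (N p.1 p.1 - mu)
  | inl (inr p) => if e p.1 p.2 then 4^-1 * laplacian_adj N p.1 p.2 else 0
  | inr s => (-1) ^+ s * mu
  end.
pose b (t : T) : R :=
  match t with
  | inl (inr p) => if e p.1 p.2 then 1 else 0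
  | inr true => - 2
  | _ => 0
  end.
pose f (v : 'rV[R]_(1 + n * n)) : R := lsubmx v 0 0.
have feasP v : (forall t, b t <= ell t v) <->
    [/\ psd (vec_mx (rsubmx v)), forall i, vec_mx (rsubmx v) i i = f v,
     forall i j, e i j -> 1 <= 4^-1 * laplacian_adj (vec_mx (rsubmx v)) i j
     & 0 <= f v <= 2].
  split=> [h|[[hs hp] hd he hf] [[[[x|[i j]]|[i s]]|[i j]]|[]]] /=.
  - split; first split.
    + apply/matrixP => i j; rewrite mxE.
      have := h (inl (inl (inl (inr (i, j))))).
      have := h (inl (inl (inl (inr (j, i))))) => /=.
      by rewrite !subr_ge0 => h1 h2; apply/eqP; rewrite eq_le h1 h2.
    + by move=> x; exact: (h (inl (inl (inl (inl x))))).
    + move=> i; have := h (inl (inl (inr (i, true)))).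
      by have := h (inl (inl (inr (i, false)))); rewrite /= expr0 expr1 /f; lra.
    + by move=> i j eij; have := h (inl (inr (i, j))); rewrite /= eij.
    + have := h (inr true); have := h (inr false); rewrite /= expr0 expr1 -/(f v).
      by move=> h1 h2; apply/andP; split; lra.
  - exact: hp.
  - suff -> : vec_mx (rsubmx v) i j = vec_mx (rsubmx v) j i by rewrite subrr.
    by rewrite -[in LHS]hs [LHS]mxE.
  - by rewrite hd subrr mulr0.
  - by case: ifP => // /he.
  - by rewrite expr1 -/(f v); lra.
  - by rewrite expr0 -/(f v); lra.
have [||||c /feasP[cp cd ce /andP[c0 c2]] cmin] :=
    @linear_min_attained R _ _ ell b f 2.
- have Nlin a (u v : 'rV[R]_(1 + n * n)) : vec_mx (rsubmx (a *: u + v))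
      = a *: vec_mx (rsubmx u) + vec_mx (rsubmx v) :> 'M[R]_n.
    by rewrite !linearP.
  have mulin a (u v : 'rV[R]_(1 + n * n)) : lsubmx (a *: u + v) 0 0
      = a * lsubmx u 0 0 + lsubmx v 0 0 by rewrite !mxE.
  move=> [[[[x|[i j]]|[i s]]|[i j]]|s] a u v; rewrite /ell /= ?Nlin ?mulin.
  + exact: quad_lin.
  + by rewrite !mxE; ring.
  + by rewrite !mxE; ring.
  + by case: (e i j); rewrite /laplacian_adj ?mxE; ring.
  + by ring.
- by move=> a u v; rewrite /f !linearP /= !mxE.
- exists (row_mx 2%:M (mxvec 2%:M)); apply/feasP.
  rewrite /f row_mxKl row_mxKr mxvecK; split=> [|i|i j eij|].
  + exact: psd_scalar.
  + by rewrite !mxE !eqxx.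
  + have ij : (i == j) = false by apply/eqP => ij; rewrite ij eirr in eij.
    by rewrite /laplacian_adj !mxE !eqxx ij mulr1n mulr0n; lra.
  + by rewrite mxE eqxx mulr1n; lra.
- move=> v /feasP[vp vd _ /andP[v0 v2]] j; rewrite -[v]hsubmxK.
  case: (split_ordP j) => {}j ->.
    by rewrite row_mxEl (ord1 j) -/(f v) ger0_norm.
  rewrite row_mxEr -[rsubmx v]vec_mxK.
  case/mxvec_indexP: j => i j; rewrite mxvecE; apply: le_trans v2.
  exact: psd_entry_bound.
have cv : eta_polar_values R e (f c) by split=> //; exists (vec_mx (rsubmx c)).
have cl : lbound (eta_polar_values R e) (f c).
  move=> mu [mu0 [N [Np Nd Ne]]]; have [mu2|/ltW] := leP mu 2; last first.
    exact: le_trans.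
  have := cmin (row_mx mu%:M (mxvec N)).
  have fE : f (row_mx mu%:M (mxvec N)) = mu.
    by rewrite /f row_mxKl mxE eqxx.
  rewrite fE; apply; apply/feasP; rewrite fE row_mxKr mxvecK.
  by split=> //; rewrite mu0 mu2.
suff -> : etaG_polar R e = f c by [].
apply/eqP; rewrite eq_le; apply/andP; split.
  by apply: ge_inf => //; exists (f c).
by apply: lb_le_inf => //; exists (f c).
Qed.

(* Main.v *)
(* For any graph, a feasible [N] with diagonal [mu] gives the feasible [N / mu]
   for [etaG], so [|E| <= etaG * etaG_polar].  For the converse, project an
   optimal [M] for [etaG] orthogonally onto the span of the coherent
   configuration: as this span is a matrix algebra closed under transposition,
   the projection [M'] is again positive semidefinite; it still has unit
   diagonal and the same objective value, and all its edge entries coincide.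
   Hence every edge contributes [etaG / |E|] to the objective, and
   [(|E| / etaG) M'] is feasible for [etaG_polar]. *)
Require Import Defs.
From mathcomp Require Import all_boot all_order all_algebra.
From mathcomp Require Import all_classical all_reals all_analysis.
From mathcomp Require Import ring lra.

Set Implicit Arguments.
Unset Strict Implicit.
Unset Printing Implicit Defensive.

Import Order.TTheory GRing.Theory Num.Theory.
Import numFieldNormedType.Exports.

Local Open Scope classical_set_scope.
Local Open Scope ring_scope.

(** * Quadratic forms on the unit sphere and negative eigenvalues *)

Lemma quad_form_continuous (R : realType) (n : nat) (Y : 'M[R]_n) :
  continuous (fun v : 'rV[R]_n => (v *m Y *m v^T) 0 0).
Proof.
have -> : (fun v : 'rV[R]_n => (v *m Y *m v^T) 0 0)
    = (fun v => \sum_j (v *m Y) 0 j * v 0 j).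
  by apply/funext => v; rewrite mxE; apply: eq_bigr => j _; rewrite [v^T _ _]mxE.
elim: (index_enum _) => [|j s IH].
  under eq_fun do rewrite big_nil.
  exact: cst_continuous.
under eq_fun do rewrite big_cons.
have lin : continuous (fun v : 'rV[R]_n => (v *m Y) 0 j).
  by apply: linear_form_continuous => a u w; rewrite mulmxDl -scalemxAl !mxE.
move=> v; exact: (cvgD (cvgM (lin v) (@coord_continuous R 1 n 0 j v)) (IH v)).
Qed.

Lemma dot_self_ge0 (R : realType) (n : nat) (v : 'rV[R]_n) :
  0 <= (v *m v^T) 0 0.
Proof. by rewrite mxE sumr_ge0 // => j _; rewrite mxE -expr2 sqr_ge0. Qed.

Lemma dot_self_eq0 (R : realType) (n : nat) (v : 'rV[R]_n) :
  (v *m v^T) 0 0 = 0 -> v = 0.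
Proof.
rewrite mxE => /eqP; rewrite psumr_eq0 => [/allP h|j _]; last first.
  by rewrite mxE -expr2 sqr_ge0.
apply/rowP => j; have := h j (mem_index_enum j).
by rewrite /= !mxE mulf_eq0 orbb => /eqP.
Qed.

Lemma sphere_compact (R : realType) (n : nat) :
  compact [set v : 'rV[R]_n | (v *m v^T) 0 0 = 1].
Proof.
have cK : compact [set v : 'rV[R]_n | forall j, `[- 1, 1]%classic (v 0 j)].
  apply: (@rV_compact R n (fun=> `[- 1, 1]%classic)) => _.
  exact: segment_compact.
apply: subclosed_compact cK _.
  have -> : [set v : 'rV[R]_n | (v *m v^T) 0 0 = 1]
      = (fun v : 'rV[R]_n => (v *m 1%:M *m v^T) 0 0) @^-1` [set x | x = 1].
    by apply/seteqP; split=> v /=; rewrite mulmx1.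
  apply: preimage_closed; last exact: closed_eq.
  by move=> v _; exact: quad_form_continuous.
move=> v /= v1 j; rewrite /= in_itv /= -ler_norml.
rewrite -(@expr_le1 _ 2) // real_normK ?num_real // -v1 mxE (bigD1 j) //=.
rewrite mxE -expr2 lerDl sumr_ge0 // => i _.
by rewrite mxE -expr2 sqr_ge0.
Qed.

(* Over the unit sphere the quadratic form of [Y] attains its minimum [l] at
   some [c]; then [Y - l] is positive semidefinite and isotropic at [c]. *)
Lemma symmetric_min_eigenvalue (R : realType) (n : nat) (Y : 'M[R]_n)
    (x : 'rV[R]_n) :
  Y^T = Y -> (x *m Y *m x^T) 0 0 < 0 ->
  exists2 l, l < 0 & eigenvalue Y l.
Proof.
move=> Ysym xneg.
pose Q (u v : 'rV[R]_n) := (u *m Y *m v^T) 0 0 : R.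
pose D (u v : 'rV[R]_n) := (u *m v^T) 0 0 : R.
have QD u v w a : Q (u + a *: v) w = Q u w + a * Q v w.
  by rewrite /Q !mulmxDl -!scalemxAl !mxE.
have DD u v w a : D (u + a *: v) w = D u w + a * D v w.
  by rewrite /D !mulmxDl -!scalemxAl !mxE.
have tr00 (X : 'M[R]_1) : X 0 0 = X^T 0 0 by rewrite mxE.
have QC u v : Q u v = Q v u.
  by rewrite /Q tr00 !trmx_mul trmxK Ysym mulmxA.
have DC u v : D u v = D v u by rewrite /D tr00 trmx_mul trmxK.
have QZ a v : Q (a *: v) (a *: v) = a ^+ 2 * Q v v.
  by rewrite /Q linearZ /= -!scalemxAl -scalemxAr !mxE; ring.
have DZ a v : D (a *: v) (a *: v) = a ^+ 2 * D v v.
  by rewrite /D linearZ /= -!scalemxAl -scalemxAr !mxE; ring.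
have unit_vec v : v != 0 -> D ((Num.sqrt (D v v))^-1 *: v)
    ((Num.sqrt (D v v))^-1 *: v) = 1 /\ 0 < D v v.
  move=> v0; have Dv : 0 < D v v.
    rewrite lt_def dot_self_ge0 andbT; apply: contra v0 => /eqP h.
    by apply/eqP; exact: dot_self_eq0.
  by rewrite DZ exprVn sqr_sqrtr ?(ltW Dv) // mulVf ?gt_eqF.
have x0 : x != 0.
  by apply: contraTneq xneg => ->; rewrite !mul0mx mxE ltxx.
have [||c c1 cmin] := @EVT_min_rV R n (fun v => Q v v) _ _ (@sphere_compact R n).
- by eexists; exact: (unit_vec x x0).1.
- exact/continuous_subspaceT/quad_form_continuous.
rewrite inE /= in c1.
(* Homogeneity extends the minimum on the sphere to a bound on all vectors. *)
have Qmin v : Q c c * D v v <= Q v v.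
  have [->|v0] := eqVneq v 0; first by rewrite -(scale0r c) QZ DZ; lra.
  have [v1 Dv] := unit_vec v v0.
  have := cmin ((Num.sqrt (D v v))^-1 *: v); rewrite inE => /(_ v1).
  by rewrite QZ exprVn sqr_sqrtr ?(ltW Dv) // mulrC ler_pdivlMr.
exists (Q c c).
  rewrite -(pmulr_llt0 _ (unit_vec x x0).2); exact: le_lt_trans (Qmin x) xneg.
apply/eigenvalueP; exists c; last first.
  by apply: contraTneq (@ltr01 R) => c0; rewrite -c1 c0 mul0mx mxE ltxx.
set l := Q c c in Qmin *; pose w := c *m Y - l *: c.
have wD : D w w = Q c w - l * D c w.
  by rewrite {1}/w -scaleNr DD mulNr.
suff /dot_self_eq0/eqP : D w w = 0 by rewrite subr_eq0 => /eqP.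
(* The form [Q - l D] is nonnegative at [c + t w] and vanishes at [c]; its linear coefficient in [t]
   is [2 D w w], since [w] is the residual [c Y - l c]. *)
have h t : 0 <= 2 * t * D w w + t ^+ 2 * (Q w w - l * D w w).
  have := Qmin (c + t *: w); rewrite QD DD !(QC _ (c + _)) !(DC _ (c + _)) !QD !DD.
  rewrite (c1 : D c c = 1) (QC w c) (DC w c) -/l wD; lra.
have Dw := dot_self_ge0 w; rewrite -/(D w w) in Dw.
have := Qmin w; rewrite -subr_ge0; move: h Dw.
move: (D w w) (Q w w - _) => a b h a0 b0.
have b1 : 0 < 1 + b by lra.
(* This [t] makes the quadratic [2ta + t^2 b] nonpositive, which forces [a = 0]; dividing by [1 + b]
   instead of [b] covers [b = 0]. *)
have := h (- (a / (1 + b))).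
have -> : 2 * - (a / (1 + b)) * a + (- (a / (1 + b))) ^+ 2 * b
    = - (a ^+ 2 * (2 + b)) / (1 + b) ^+ 2 by field; rewrite gt_eqF.
rewrite ler_pdivlMr ?exprn_gt0 // mul0r oppr_ge0 => ab.
apply/eqP; rewrite -sqrf_eq0 eq_le sqr_ge0 andbT.
have b2 : 0 < 2 + b by lra.
by rewrite -(pmulr_lle0 _ b2).
Qed.

(** * The trace inner product *)

Lemma trace_ipE (R : realType) (n : nat) (X Y : 'M[R]_n) :
  trace_ip X Y = \sum_i \sum_j X i j * Y i j.
Proof.
rewrite /trace_ip /mxtrace; apply: eq_bigr => i _.
by rewrite mxE; apply: eq_bigr => j _; rewrite mxE.
Qed.

Lemma trace_ipC (R : realType) (n : nat) (X Y : 'M[R]_n) :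
  trace_ip X Y = trace_ip Y X.
Proof. by rewrite /trace_ip -mxtrace_tr trmx_mul trmxK. Qed.

Lemma trace_ip_tr (R : realType) (n : nat) (X Y : 'M[R]_n) :
  trace_ip X^T Y^T = trace_ip X Y.
Proof. by rewrite /trace_ip trmxK mxtrace_mulC -/(trace_ip Y X) trace_ipC. Qed.

Lemma trace_ip_sumr (R : realType) (n : nat) (I : finType) (X : 'M[R]_n)
    (c : I -> R) (Y : I -> 'M[R]_n) :
  trace_ip X (\sum_i c i *: Y i) = \sum_i c i * trace_ip X (Y i).
Proof.
elim/big_rec2: _ => [|i y Z _ <-]; last exact: trace_ip_lin.
by rewrite /trace_ip trmx0 mulmx0 mxtrace0.
Qed.

Lemma trace_ip_self_ge0 (R : realType) (n : nat) (X : 'M[R]_n) :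
  0 <= trace_ip X X.
Proof.
by rewrite trace_ipE; apply: sumr_ge0 => i _; apply: sumr_ge0 => j _;
  rewrite -expr2 sqr_ge0.
Qed.

Lemma trace_ip_self_eq0 (R : realType) (n : nat) (X : 'M[R]_n) :
  trace_ip X X = 0 -> X = 0.
Proof.
have nn i j : 0 <= X i j * X i j by rewrite -expr2 sqr_ge0.
move/eqP; rewrite trace_ipE psumr_eq0 => [/allP h|i _]; last exact: sumr_ge0.
apply/matrixP => i j; have := h i (mem_index_enum i).
rewrite psumr_eq0 // => /allP/(_ j (mem_index_enum j)).
by rewrite mulf_eq0 orbb mxE => /eqP.
Qed.

(** * Projection onto a matrix algebra preserves positive semidefiniteness *)

(** By cyclicity this is the trace of [B^T M B], whose diagonal entries are the quadratic form of
    [M] at the columns of [B]. *)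
Lemma psd_trace_ip_gram (R : realType) (n : nat) (M B : 'M[R]_n) :
  psd M -> 0 <= trace_ip M (B *m B^T).
Proof.
move=> [_ Mpos]; rewrite /trace_ip trmx_mul trmxK mulmxA mxtrace_mulC mulmxA.
rewrite sumr_ge0 // => i _; have := Mpos (col i B).
by rewrite colE trmx_mul trmx_delta !mulmxA -colE -!mulmxA -rowE !mulmxA !mxE.
Qed.

(** Take [q] to be the minimal polynomial of [Y] divided by [X - l]: its degree is too small to
    annihilate [Y]. Unlike an eigenvector, [q(Y)] stays in every unital matrix algebra containing
    [Y]. *)
Lemma eigenvalue_horner (R : realType) (n : nat) (Y : 'M[R]_n.+1) (l : R) :
  eigenvalue Y l ->
  exists2 q, horner_mx Y q != 0 & Y *m horner_mx Y q = l *: horner_mx Y q.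
Proof.
rewrite eigenvalue_root_min => /factor_theorem[q pq]; exists q.
  apply/eqP => /mxminpoly_min; rewrite pq => /dvdp_leq.
  have q0 : q != 0.
    by apply: contraTneq (mxminpoly_monic Y) => q0; rewrite pq q0 mul0r monicE
      lead_coef0 eq_sym oner_eq0.
  by move/(_ q0); rewrite size_Mmonic ?monicXsubC // size_XsubC addn2 /= ltnn.
have := mx_root_minpoly Y; rewrite pq mulrC rmorphM rmorphB /= horner_mx_X.
rewrite horner_mx_C mulrBl => /eqP; rewrite subr_eq0 => /eqP.
by rewrite [RHS]mul_scalar_mx.
Qed.

(* A negative eigenvalue [l] of [Y] would give a nonzero [B = q(Y)] in [S] with
   [Y B = l B], and then [0 <= <M, B B^T> = <Y, B B^T> = l <B, B> < 0]. *)
Lemma psd_algebra_projection (R : realType) (n : nat)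
    (S : 'M[R]_n.+1 -> Prop) (M Y : 'M[R]_n.+1) :
  S 1%:M -> (forall a X Z, S X -> S Z -> S (a *: X + Z)) ->
  (forall X Z, S X -> S Z -> S (X *m Z)) -> (forall X, S X -> S X^T) ->
  psd M -> S Y -> Y^T = Y ->
  (forall X, S X -> trace_ip X Y = trace_ip X M) -> psd Y.
Proof.
move=> S1 SL SM ST Mpsd SY Ysym YM; split=> // x; rewrite leNgt; apply/negP => xneg.
have [|l l0 /eigenvalue_horner[q]] := @symmetric_min_eigenvalue R n.+1 Y x^T Ysym.
  by rewrite trmxK.
have : S (horner_mx Y q).
  have S0 : S 0 by rewrite -(addNr 1%:M) -scaleN1r; exact: SL.
  elim/poly_ind: q => [|q c Sq]; first by rewrite rmorph0.
  rewrite rmorphD rmorphM /= horner_mx_X horner_mx_C addrC -scalemx1.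
  by apply: SL => //; apply: SM.
move: (horner_mx Y q) => B SB B0 YB.
have := psd_trace_ip_gram B Mpsd.
rewrite trace_ipC -YM; last by apply: SM => //; exact: ST.
rewrite trace_ipC /trace_ip trmx_mul trmxK mulmxA YB -scalemxAl mxtraceZ.
rewrite -/(trace_ip B B) nmulr_rge0 // => BB; move/eqP: B0; apply.
by apply: trace_ip_self_eq0; apply/eqP; rewrite eq_le BB trace_ip_self_ge0.
Qed.

(** * Coherent configurations and the projection onto their span *)

(** The 0/1 entries at one position sum to 1, so the supports of the [C i] partition the positions
    into cells. *)
Lemma coherent_cell (R : realType) (n d : nat) (C : 'I_d.+1 -> 'M[R]_n) a b :
  coherent_configuration C -> exists i, forall j, C j a b = (j == i)%:R.
Proof.
move=> CC; have S1 : \sum_j C j a b = 1 by rewrite -summxE (cc_sum CC) mxE.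
have C0 j : 0 <= C j a b by case: (cc_01 CC j a b) => ->.
have [i Ci] : exists i, C i a b = 1.
  apply: contrapT => /forallNP h; move/eqP: S1.
  rewrite eq_sym big1 ?oner_eq0 // => j _.
  by case: (cc_01 CC j a b) => // /h.
exists i => j; have [->//|ji] := eqVneq j i.
move: S1; rewrite (bigD1 i) //= Ci => /eqP; rewrite addrC -subr_eq0 addrK.
by rewrite psumr_eq0 // => /allP/(_ j (mem_index_enum j)); rewrite ji => /eqP.
Qed.

Definition coherent_span (R : realType) (n d : nat) (C : 'I_d.+1 -> 'M[R]_n)
    (X : 'M[R]_n) : Prop :=
  exists c : 'I_d.+1 -> R, X = \sum_i c i *: C i.

(* The orthogonal projection onto the span of [C]: the coefficient at a zero
   matrix [C i] is [0 / 0 = 0]. *)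
Definition coherent_proj (R : realType) (n d : nat) (C : 'I_d.+1 -> 'M[R]_n)
    (M : 'M[R]_n) : 'M[R]_n :=
  \sum_i (trace_ip (C i) M / trace_ip (C i) (C i)) *: C i.

Lemma coherent_projE (R : realType) (n d : nat) (C : 'I_d.+1 -> 'M[R]_n)
    (M : 'M[R]_n) i a b :
  coherent_configuration C -> C i a b = 1 ->
  coherent_proj C M a b = trace_ip (C i) M / trace_ip (C i) (C i).
Proof.
move=> CC; have [j Cj] := coherent_cell a b CC.
rewrite Cj; case: eqP => [-> _|_ /eqP]; last by rewrite eq_sym oner_eq0.
rewrite summxE (bigD1 j) //= mxE Cj eqxx mulr1 big1 ?addr0 // => k kj.
by rewrite mxE Cj (negPf kj) mulr0.
Qed.

Lemma trace_ip_coherent_proj (R : realType) (n d : nat)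
    (C : 'I_d.+1 -> 'M[R]_n) (M : 'M[R]_n) i :
  coherent_configuration C ->
  trace_ip (C i) (coherent_proj C M) = trace_ip (C i) M.
Proof.
move=> CC; have [C0|C0] := eqVneq (trace_ip (C i) (C i)) 0.
  by rewrite (trace_ip_self_eq0 C0) /trace_ip !mul0mx.
have -> : trace_ip (C i) (coherent_proj C M)
    = trace_ip (C i) M / trace_ip (C i) (C i) * trace_ip (C i) (C i).
  rewrite [LHS]trace_ipE [X in _ * X]trace_ipE mulr_sumr.
  apply: eq_bigr => a _; rewrite mulr_sumr; apply: eq_bigr => b _.
  case: (cc_01 CC i a b) => Cab; first by rewrite Cab !mul0r mulr0.
  by rewrite (coherent_projE _ CC Cab) Cab !mul1r mulr1.
by rewrite divfK.
Qed.

(** The projection averages [M] over each cell; transposition permutes the cells and, for symmetric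
    [M], preserves these averages. *)
Lemma coherent_proj_sym (R : realType) (n d : nat) (C : 'I_d.+1 -> 'M[R]_n)
    (M : 'M[R]_n) :
  coherent_configuration C -> M^T = M ->
  (coherent_proj C M)^T = coherent_proj C M.
Proof.
move=> CC Msym; apply/matrixP => a b; rewrite mxE.
have [i Ci] := coherent_cell a b CC.
have Cab : C i a b = 1 by rewrite Ci eqxx.
have [j Cj] := cc_tr CC i.
have Cba : C j b a = 1 by rewrite -Cj mxE.
rewrite (coherent_projE _ CC Cab).
rewrite (coherent_projE _ CC Cba) -Cj.
by rewrite -(trace_ip_tr (C i) M) -(trace_ip_tr (C i) (C i)) Msym.
Qed.

(** A cell that meets the diagonal lies inside it, so [M] averages to 1 there. *)
Lemma coherent_proj_diag (R : realType) (n d : nat) (C : 'I_d.+1 -> 'M[R]_n)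
    (M : 'M[R]_n) :
  coherent_configuration C -> (forall a, M a a = 1) ->
  forall a, coherent_proj C M a a = 1.
Proof.
move=> CC Mdiag a; have [i Ci] := coherent_cell a a CC.
have Caa : C i a a = 1 by rewrite Ci eqxx.
have /is_diag_mxP dC : is_diag_mx (C i).
  by apply: (cc_diag CC); exists a; rewrite Caa oner_eq0.
rewrite (coherent_projE _ CC Caa).
suff -> : trace_ip (C i) M = trace_ip (C i) (C i).
  apply: divff; apply/eqP => /trace_ip_self_eq0 C0.
  by move/eqP: Caa; rewrite C0 mxE eq_sym oner_eq0.
rewrite !trace_ipE; apply: eq_bigr => b _; apply: eq_bigr => c _.
case: (cc_01 CC i b c) => Cbc; rewrite Cbc ?mul0r // !mul1r.
have [<-//|bc] := eqVneq b c.
by move/eqP: Cbc; rewrite dC // eq_sym oner_eq0.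
Qed.

Lemma coherent_proj_psd (R : realType) (n d : nat) (C : 'I_d.+1 -> 'M[R]_n)
    (M : 'M[R]_n) :
  coherent_configuration C -> psd M -> psd (coherent_proj C M).
Proof.
(* Evaluating polynomials at a matrix requires positive size; size 0 is trivial. *)
case: n C M => [|n] C M CC Mpsd.
  by split=> [|x]; rewrite ?(flatmx0 x) ?mulmx0 ?mxE //; apply/matrixP => [[]].
have SD a X Z : coherent_span C X -> coherent_span C Z ->
    coherent_span C (a *: X + Z).
  move=> [c ->] [c' ->]; exists (fun i => a * c i + c' i).
  rewrite scaler_sumr -big_split; apply: eq_bigr => i _.
  by rewrite scalerDl scalerA.
have S0 : coherent_span C 0.
  by exists (fun=> 0); rewrite big1 // => i _; rewrite scale0r.
have SC i : coherent_span C (C i).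
  exists (fun j => (j == i)%:R); rewrite (bigD1 i) //= eqxx scale1r big1 ?addr0 //.
  by move=> j /negPf ->; rewrite scale0r.
have Ssum (c : 'I_d.+1 -> R) (F : 'I_d.+1 -> 'M[R]_n.+1) :
    (forall i, coherent_span C (F i)) ->
    coherent_span C (\sum_i c i *: F i).
  move=> SF; elim/big_ind: _ => // [X Z SX SZ|i _].
    by rewrite -[X]scale1r; exact: SD.
  by rewrite -[c i *: F i]addr0; exact: SD.
apply: (@psd_algebra_projection R n (coherent_span C) M) => //.
(* The identity is the sum of the diagonal members of [C]. *)
- exists (fun i => (is_diag_mx (C i))%:R); apply/matrixP => a b.
  have [i Ci] := coherent_cell a b CC.
  have Cab : C i a b = 1 by rewrite Ci eqxx.
  rewrite [LHS]mxE summxE (bigD1 i) //= mxE Cab mulr1 big1 ?addr0 => [|j ji]; last first.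
    by rewrite mxE Ci (negPf ji) mulr0.
  congr (nat_of_bool _)%:R; apply/eqP/idP => [ab|/is_diag_mxP dC].
    by apply: (cc_diag CC); exists a; rewrite {2}ab Cab oner_eq0.
  apply/eqP; apply: contraTT isT => ab.
  by move/eqP: Cab; rewrite dC // eq_sym oner_eq0.
- move=> _ _ [c ->] [c' ->]; rewrite mulmx_suml.
  under eq_bigr do rewrite -scalemxAl mulmx_sumr.
  apply: (Ssum) => i; under eq_bigr do rewrite -scalemxAr.
  apply: (Ssum) => j; have [p ->] := cc_mul CC.
  exact: Ssum.
- move=> _ [c ->]; rewrite linear_sum; under eq_bigr do rewrite linearZ /=.
  by apply: Ssum => i; have [j ->] := cc_tr CC i.
- by eexists.
- by apply: coherent_proj_sym => //; case: Mpsd.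
- move=> _ [c ->]; rewrite trace_ipC [RHS]trace_ipC !trace_ip_sumr.
  by apply: eq_bigr => i _; rewrite trace_ipC trace_ip_coherent_proj // trace_ipC.
Qed.

(** * The objective as a sum over edges *)

(** The adjacency matrix counts each edge in both orders, while [edges] keeps only the increasing
    one; swapping coordinates matches the two halves. *)
Lemma sum_edges_adjacency (R : realType) (n : nat) (e : rel 'I_n)
    (N : 'M[R]_n) :
  simple_graph e -> N^T = N ->
  trace_ip (adjacency R e) N = \sum_(p in edges e) 2 * N p.1 p.2.
Proof.
move=> [esym eirr] Nsym.
have -> : trace_ip (adjacency R e) N
    = \sum_(p : 'I_n * 'I_n | e p.1 p.2) N p.1 p.2.
  rewrite trace_ipE pair_bigA [RHS]big_mkcond; apply: eq_bigr => [[i j] _] /=.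
  by rewrite mxE; case: (e i j); rewrite ?mul1r ?mul0r.
rewrite (bigID (fun p : 'I_n * 'I_n => p.1 < p.2)%N) /=.
have swap_inj : injective (fun p : 'I_n * 'I_n => (p.2, p.1)).
  by move=> [i j] [k l] /= [-> ->].
rewrite [X in _ + X](reindex_inj swap_inj) /=.
under [RHS]eq_bigr do rewrite mulr_natl mulr2n.
rewrite big_split /=; congr (_ + _).
  by apply: eq_bigl => p; rewrite inE andbC.
apply: eq_big => [[i j]|[i j] _] /=; last by rewrite -[in LHS]Nsym mxE.
rewrite inE /= andbC -leqNgt leq_eqVlt esym.
by case: eqP => [/val_inj ->|//]; rewrite eirr !andbF.
Qed.

(** By cyclicity of the trace, each rank-one term gives the quadratic form of [M] at [e_i - e_j]. *)
Lemma trace_ip_laplacian (R : realType) (n : nat) (e : rel 'I_n)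
    (M : 'M[R]_n) :
  M^T = M ->
  trace_ip (laplacian R e) M = \sum_(p in edges e) laplacian_adj M p.1 p.2.
Proof.
move=> Msym; rewrite trace_ipC /laplacian.
have tD X Y : trace_ip M (X + Y) = trace_ip M X + trace_ip M Y.
  by rewrite -[X in LHS]scale1r trace_ip_lin mul1r.
have t0 : trace_ip M 0 = 0 by rewrite /trace_ip trmx0 mulmx0 mxtrace0.
rewrite (big_morph (trace_ip M) tD t0); apply: eq_bigr => [[i j] _] /=.
rewrite /trace_ip trmx_mul trmxK mulmxA mxtrace_mulC [LHS]trace_mx11.
have bil (u v : 'I_n) : ((basis_vec R u)^T *m M *m basis_vec R v) 0 0 = M u v.
  by rewrite /basis_vec trmx_delta -rowE -colE !mxE.
have addE (X Y : 'M[R]_1) : (X + Y) 0 0 = X 0 0 + Y 0 0 by rewrite mxE.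
have oppE (X : 'M[R]_1) : (- X) 0 0 = - X 0 0 by rewrite mxE.
have Mji : M j i = M i j by rewrite -[in LHS]Msym mxE.
rewrite mulmxA [(_ - _)^T]linearB /= !(mulmxBl, mulmxBr) !(addE, oppE) !bil Mji.
by rewrite /laplacian_adj; ring.
Qed.

(** Every edge position lies in one fixed cell or in its transpose, and the symmetric projection
    takes the same value on both. *)
Lemma coherent_proj_edge (R : realType) (n d : nat) (C : 'I_d.+1 -> 'M[R]_n)
    (e : rel 'I_n) (M : 'M[R]_n) :
  coherent_configuration C ->
  belongs_to (adjacency R e) C \/ splits_in (adjacency R e) C -> M^T = M ->
  exists c, forall i j, e i j -> coherent_proj C M i j = c.
Proof.
move=> CC AC Msym.
have [k Ak] : exists k, forall i j, e i j -> C k i j = 1 \/ C k j i = 1.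
  case: AC => [] [k Ak]; exists k => i j eij;
    have := congr1 (fun X : 'M[R]_n => X i j) Ak; rewrite !mxE eij; first by left.
  case: (cc_01 CC k i j) => Ckij; last by left.
  by rewrite Ckij add0r; right.
exists (trace_ip (C k) M / trace_ip (C k) (C k)) => i j /Ak[|] Ck.
  exact: coherent_projE.
by rewrite -(coherent_proj_sym CC Msym) mxE; exact: coherent_projE.
Qed.

Lemma trace_ip_adjacency_coherent_proj (R : realType) (n d : nat)
    (C : 'I_d.+1 -> 'M[R]_n) (e : rel 'I_n) (M : 'M[R]_n) :
  coherent_configuration C ->
  belongs_to (adjacency R e) C \/ splits_in (adjacency R e) C ->
  trace_ip (adjacency R e) (coherent_proj C M) = trace_ip (adjacency R e) M.
Proof.
move=> CC [] [k ->]; first exact: trace_ip_coherent_proj.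
have [j ->] := cc_tr CC k; rewrite trace_ipC [RHS]trace_ipC.
rewrite -[C k]scale1r !trace_ip_lin; congr (_ * _ + _);
  by rewrite trace_ipC trace_ip_coherent_proj // trace_ipC.
Qed.

(** With unit diagonal, the objective depends on [M] only through its product with the adjacency
    matrix, which the projection preserves. *)
Lemma trace_ip_laplacian_adjacency (R : realType) (n : nat) (e : rel 'I_n)
    (M : 'M[R]_n) :
  simple_graph e -> M^T = M -> (forall i, M i i = 1) ->
  trace_ip (laplacian R e) M
    = 2 * #|edges e|%:R - trace_ip (adjacency R e) M.
Proof.
move=> G Msym Mdiag; rewrite trace_ip_laplacian // sum_edges_adjacency //.
rewrite mulr_natr -sumr_const -sumrB; apply: eq_bigr => p _.
by rewrite /laplacian_adj !Mdiag.
Qed.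

(** * The two inequalities *)

Lemma psdZ (R : realType) (n : nat) (a : R) (M : 'M[R]_n) :
  0 <= a -> psd M -> psd (a *: M).
Proof.
move=> a0 [Msym Mpos]; split; first by rewrite linearZ /= Msym.
by move=> x; rewrite -scalemxAr -scalemxAl mxE mulr_ge0.
Qed.

Lemma card_edges_le_eta_polar (R : realType) (n : nat) (e : rel 'I_n) (mu : R) :
  eta_polar_values R e mu -> #|edges e|%:R <= etaG R e * mu.
Proof.
move=> [mu0 [N [Npsd Ndiag Nedge]]].
have [E0|[[i j]]] := set_0Vmem (edges e).
  (* Without edges only [0 <= etaG R e] is needed; the identity attains the value 0. *)
  rewrite E0 cards0 mulr_ge0 //; apply: (eta_is_max R e).2.
  exists 1%:M; split=> [|i|]; first exact: psd_scalar.
    by rewrite mxE eqxx.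
  rewrite trace_ip_laplacian ?tr_scalar_mx // E0 big_set0 mulr0 //.
rewrite inE => /andP[_ eij].
(* An edge gives [4 <= 2 mu - 2 N i j], and [N i j] is at least [- mu]. *)
have mu_gt0 : 0 < mu.
  have := Nedge _ _ eij; rewrite /laplacian_adj !Ndiag.
  by have := psd_entry_bound Npsd Ndiag i j; rewrite ler_norml => /andP[]; lra.
rewrite -ler_pdivrMr //; apply: (le_trans _ ((eta_is_max R e).2 _ _)); last first.
  exists (mu^-1 *: N); split=> [|k|]; last by [].
    by apply: psdZ => //; rewrite invr_ge0.
  by rewrite mxE Ndiag mulVf // gt_eqF.
rewrite -[_ *: N]addr0 trace_ip_lin {2}/trace_ip trmx0 mulmx0 mxtrace0 addr0.
rewrite mulrCA [leLHS]mulrC ler_pM2l ?invr_gt0 //.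
rewrite trace_ip_laplacian; last by case: Npsd.
rewrite mulr_sumr -sumr_const; apply: ler_sum => p.
by rewrite inE => /andP[_]; exact: Nedge.
Qed.

Lemma eta_polar_le (R : realType) (n : nat) (e : rel 'I_n) (d : nat)
    (C : 'I_d.+1 -> 'M[R]_n) :
  simple_graph e -> coherent_configuration C ->
  belongs_to (adjacency R e) C \/ splits_in (adjacency R e) C ->
  edges e != finset.set0 ->
  etaG R e * etaG_polar R e <= #|edges e|%:R.
Proof.
move=> G CC AC E0.
have [[M [Mpsd Mdiag etaE]] eta_ub] := eta_is_max R e.
have Msym : M^T = M by case: Mpsd.
have [c Pc] := coherent_proj_edge CC AC Msym.
set P := coherent_proj C M in Pc.
have Ppsd : psd P := coherent_proj_psd CC Mpsd.
have Psym : P^T = P by case: Ppsd.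
have Pdiag : forall a, P a a = 1 := coherent_proj_diag CC Mdiag.
set m : R := #|edges e|%:R; have m0 : 0 < m by rewrite ltr0n card_gt0.
have Padj i j : e i j -> laplacian_adj P i j = 2 - 2 * c.
  by move=> eij; rewrite /laplacian_adj !Pdiag Pc.
(* [t] is the contribution of each edge to the objective at [P]. *)
pose t : R := 4^-1 * (2 - 2 * c).
have eta_t : etaG R e = m * t.
  rewrite etaE trace_ip_laplacian_adjacency //.
  rewrite -(trace_ip_adjacency_coherent_proj _ CC AC).
  rewrite -trace_ip_laplacian_adjacency // trace_ip_laplacian //.
  rewrite (eq_bigr (fun=> 2 - 2 * c)) => [|p]; last first.
    by rewrite inE => /andP[_]; exact: Padj.
  by rewrite sumr_const -(mulr_natl (2 - 2 * c)) mulrCA.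
have t0 : 0 < t.
  rewrite -(pmulr_rgt0 _ m0) -eta_t.
  (* The identity matrix is feasible, and each edge contributes 1/2 to its value. *)
  apply: (lt_le_trans _ (eta_ub (m / 2) _)); first by rewrite divr_gt0.
  exists 1%:M; split=> [|i|]; first exact: psd_scalar.
    by rewrite mxE eqxx.
  rewrite trace_ip_laplacian_adjacency ?tr_scalar_mx //; last first.
    by move=> i; rewrite mxE eqxx.
  rewrite sum_edges_adjacency ?tr_scalar_mx // big1 => [|p]; first by rewrite -/m; lra.
  rewrite inE mxE => /andP[lt_p _].
  by rewrite -val_eqE /= ltn_eqF // mulr0.
(* It remains to show that [t^-1] is feasible for the polar problem; in [t^-1 *: P] every edge
   constraint is tight. *)
rewrite eta_t -mulrA ger_pMr // -ler_pdivlMl // mulr1.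
apply: (eta_polar_is_min R (graph_irr G)).2; split; first by rewrite invr_ge0 ltW.
exists (t^-1 *: P); split=> [|i|i j eij].
- by apply: psdZ; rewrite // invr_ge0 ltW.
- by rewrite mxE Pdiag mulr1.
- have -> : laplacian_adj (t^-1 *: P) i j = t^-1 * laplacian_adj P i j.
    by rewrite /laplacian_adj !mxE; ring.
  by rewrite Padj // mulrCA mulVf ?gt_eqF.
Qed.

Theorem theorem3 (R : realType) (n : nat) (e : rel 'I_n)
  (G_simple : simple_graph e)
  (d : nat) (C : 'I_d.+1 -> 'M[R]_n)
  (C_coherent : coherent_configuration C)
  (A_in_C : belongs_to (adjacency R e) C \/ splits_in (adjacency R e) C) :
  etaG R e * etaG_polar R e = #|edges e|%:R.
Proof.
(* In the edgeless case [etaG R e] is 0, so no division by it is possible. *)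
have [E0|E0] := eqVneq (edges e) finset.set0.
  have [[M [[Msym _] _ ->]] _] := eta_is_max R e.
  by rewrite trace_ip_laplacian // E0 big_set0 mulr0 mul0r cards0.
apply/eqP; rewrite eq_le (eta_polar_le G_simple C_coherent A_in_C E0).
exact: card_edges_le_eta_polar (eta_polar_is_min R (graph_irr G_simple)).1.
Qed.
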